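(* Let $\mathbf L$ be an $\mathrm e$-cyclic residuated lattice that satisfies at least one of the two prelinearity laws: the left prelinearity law $((x\backslash y)\wedge \mathrm e)\vee((y\backslash x)\wedge \mathrm e)\approx \mathrm e$ or the right prelinearity law $((y/x)\wedge \mathrm e)\vee((x/y)\wedge \mathrm e)\approx \mathrm e$. Then the lattice $\mathcal K(\mathcal C(\mathbf L))$ of principal convex subalgebras of $\mathbf L$, ordered by inclusion, is a relatively normal lattice.
   Context: A residuated lattice is an algebra $\mathbf L=(L,\cdot,\backslash,/,\vee,\wedge,\mathrm e)$ such that $(L,\cdot,\mathrm e)$ is a monoid, $(L,\vee,\wedge)$ is a lattice with order $\le$, and $x\cdot y\le z \iff y\le x\backslash z \iff x\le z/y$ for all $x,y,z\in L$. It is $\mathrm e$-cyclic if $\mathrm e/x=x\backslash \mathrm e$ for all $x\in L$. A convex subalgebra of $\mathbf L$ is a subalgebra (closed under all operations, containing $\mathrm e$) whose universe is order-convex. $\mathcal C(\mathbf L)$ is the lattice of convex subalgebras ordered by inclusion; a convex subalgebra is principal if it is the smallest convex subalgebra $\mathrm C[a]$ containing some element $a\in L$. The principal convex subalgebras are exactly the compact elements of $\mathcal C(\mathbf L)$; they form a sublattice $\mathcal K(\mathcal C(\mathbf L))$ of $\mathcal C(\mathbf L)$, with least element $\{\mathrm e\}$. A lower-bounded distributive lattice is relatively normal if its prime ideals form a root-system under set-inclusion, i.e. for each prime ideal, the prime ideals containing it form a chain. *)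

(* Defs.v *)
From HB Require Import structures.
From mathcomp Require Import all_boot all_order.
From mathcomp Require Import boolp classical_sets.

Set Implicit Arguments.
Unset Strict Implicit.
Unset Printing Implicit Defensive.

Import Order.TTheory.

Local Open Scope order_scope.

(* [ldiv x y] is x\y and [rdiv y x] is y/x; the constant e is the monoid unit 1. *)
HB.mixin Record isResiduated d L of Order.Lattice d L & Monoid L := {
  ldiv : L -> L -> L;
  rdiv : L -> L -> L;
  le_mul_ldiv : forall x y z : L, ((x * y)%g <= z) = (y <= ldiv x z);
  le_mul_rdiv : forall x y z : L, ((x * y)%g <= z) = (x <= rdiv z y);
}.

#[short(type="residuatedLatticeType")]
HB.structure Definition ResiduatedLattice d :=
  { L of Order.Lattice d L & Monoid L & isResiduated d L }.

HB.mixin Record isECyclic d L of ResiduatedLattice d L := {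
  ecyclic : forall x : L, rdiv 1%g x = ldiv x 1%g;
}.

#[short(type="ecyclicRLType")]
HB.structure Definition ECyclicRL d :=
  { L of ResiduatedLattice d L & isECyclic d L }.

Definition left_prelinear d (L : residuatedLatticeType d) : Prop :=
  forall x y : L, (ldiv x y `&` 1%g) `|` (ldiv y x `&` 1%g) = 1%g.

Definition right_prelinear d (L : residuatedLatticeType d) : Prop :=
  forall x y : L, (rdiv y x `&` 1%g) `|` (rdiv x y `&` 1%g) = 1%g.

Section ConvexSubalgebras.
Context {d : Order.disp_t} {L : residuatedLatticeType d}.
Implicit Types (A B X : set L) (x y z : L).

Record is_convex_subalgebra A : Prop := IsConvexSubalgebra {
  csub_one : A 1%g;
  csub_mul : forall x y, A x -> A y -> A (x * y)%g;
  csub_ldiv : forall x y, A x -> A y -> A (ldiv x y);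
  csub_rdiv : forall x y, A x -> A y -> A (rdiv x y);
  csub_meet : forall x y, A x -> A y -> A (x `&` y);
  csub_join : forall x y, A x -> A y -> A (x `|` y);
  csub_convex : forall x y z, A x -> A z -> x <= y -> y <= z -> A y
}.

Lemma convex_subalgebraI A B :
  is_convex_subalgebra A -> is_convex_subalgebra B ->
  is_convex_subalgebra (A `&` B)%classic.
Proof.
move=> cA cB; split=> [|x y [? ?] [? ?]|x y [? ?] [? ?]|x y [? ?] [? ?]
  |x y [? ?] [? ?]|x y [? ?] [? ?]|x y z [Ax Bx] [Az Bz] xy yz].
- by split; apply: csub_one.
- by split; apply: csub_mul.
- by split; apply: csub_ldiv.
- by split; apply: csub_rdiv.
- by split; apply: csub_meet.
- by split; apply: csub_join.
- by split; [apply: (csub_convex cA Ax Az)|apply: (csub_convex cB Bx Bz)].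
Qed.

Lemma smallest_convex_subalgebra X :
  is_convex_subalgebra (smallest is_convex_subalgebra X).
Proof.
split=> [|x y Ax Ay|x y Ax Ay|x y Ax Ay|x y Ax Ay|x y Ax Ay|x y z Ax Az xy yz]
  C /[dup] HC [cC XC].
- exact: csub_one.
- by apply: csub_mul => //; [apply: Ax|apply: Ay].
- by apply: csub_ldiv => //; [apply: Ax|apply: Ay].
- by apply: csub_rdiv => //; [apply: Ax|apply: Ay].
- by apply: csub_meet => //; [apply: Ax|apply: Ay].
- by apply: csub_join => //; [apply: Ax|apply: Ay].
- exact: (csub_convex cC (Ax _ HC) (Az _ HC)).
Qed.

End ConvexSubalgebras.

Section ConvexSubalgebraLattice.
Context {d : Order.disp_t}.

Record convexSubalgebra (L : residuatedLatticeType d) := ConvexSubalgebra {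
  csub_set : set L;
  _ : `[< is_convex_subalgebra csub_set >]
}.

Variable L : residuatedLatticeType d.

HB.instance Definition _ := [isSub for @csub_set L].
HB.instance Definition _ := [Choice of convexSubalgebra L by <:].
(* The order on [set L] is inclusion. *)
HB.instance Definition _ :=
  [SubChoice_isSubPOrder of convexSubalgebra L by <: with set_display].

Implicit Types A B C : convexSubalgebra L.

Lemma csubP A : is_convex_subalgebra (csub_set A).
Proof. exact/asboolP/(valP A). Qed.

Lemma csub_leP A B : (A <= B) <-> (csub_set A `<=` csub_set B)%classic.
Proof. by rewrite -Order.le_val; split=> /subsetPset. Qed.

Definition csub_gen (X : set L) : convexSubalgebra L :=
  ConvexSubalgebra (asboolT (smallest_convex_subalgebra X)).

Definition csub_inter A B : convexSubalgebra L :=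
  ConvexSubalgebra (asboolT (convex_subalgebraI (csubP A) (csubP B))).

Definition csub_union_gen A B : convexSubalgebra L :=
  csub_gen (csub_set A `|` csub_set B)%classic.

Fact csub_interP A B C : (A <= csub_inter B C) = (A <= B) && (A <= C).
Proof.
apply/idP/andP => [/csub_leP AI|[/csub_leP AB /csub_leP AC]].
  by split; apply/csub_leP => x /AI [].
by apply/csub_leP => x Ax; split; [apply: AB|apply: AC].
Qed.

Fact csub_union_genP A B C : (csub_union_gen A B <= C) = (A <= C) && (B <= C).
Proof.
apply/idP/andP => [/csub_leP UC|[/csub_leP AC /csub_leP BC]].
  split; apply/csub_leP => x Ax; apply: UC; apply: sub_gen_smallest.
    by left.
  by right.
apply/csub_leP; apply: smallest_sub; first exact: csubP.
by move=> x [/AC|/BC].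
Qed.

HB.instance Definition _ :=
  Order.POrder_MeetJoin_isLattice.Build set_display (convexSubalgebra L)
    csub_interP csub_union_genP.

(* C[a] *)
Definition csub1 (a : L) : convexSubalgebra L := csub_gen [set a]%classic.

Definition is_principal : pred (convexSubalgebra L) :=
  fun A => `[< exists a : L, A = csub1 a >].

Lemma csub1_mem a : csub_set (csub1 a) a.
Proof. exact: sub_gen_smallest. Qed.

Lemma csub1_le a A : (csub1 a <= A) <-> csub_set A a.
Proof.
split=> [/csub_leP|Aa]; first by apply; apply: csub1_mem.
by apply/csub_leP; apply: smallest_sub => [|_ ->//]; apply: csubP.
Qed.

End ConvexSubalgebraLattice.

Arguments csub1_mem {d L} a _ _.

Section Residuation.
Context {d : Order.disp_t} {L : residuatedLatticeType d}.
Implicit Types x y z p q : L.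

Lemma rl_le_mul2l z x y : x <= y -> (z * x <= z * y)%g.
Proof. by rewrite le_mul_ldiv => /le_trans; apply; rewrite -le_mul_ldiv. Qed.

Lemma rl_le_mul2r z x y : x <= y -> (x * z <= y * z)%g.
Proof. by rewrite le_mul_rdiv => /le_trans; apply; rewrite -le_mul_rdiv. Qed.

Lemma rl_le_mul x y z t : x <= y -> z <= t -> (x * z <= y * t)%g.
Proof. by move=> /(rl_le_mul2r z) xy /(rl_le_mul2l y); apply: le_trans. Qed.

Lemma rl_mulUl x y z : ((x `|` y) * z = x * z `|` y * z)%g.
Proof.
apply/eqP; rewrite eq_le leUx !rl_le_mul2r ?leUl ?leUr// andbT.
by rewrite le_mul_rdiv leUx -!le_mul_rdiv leUl leUr.
Qed.

Lemma rl_mulUr x y z : (z * (x `|` y) = z * x `|` z * y)%g.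
Proof.
apply/eqP; rewrite eq_le leUx !rl_le_mul2l ?leUl ?leUr// andbT.
by rewrite le_mul_ldiv leUx -!le_mul_ldiv leUl leUr.
Qed.

Lemma rl_ldivK x y : (x * ldiv x y <= y)%g.
Proof. by rewrite le_mul_ldiv. Qed.

Lemma rl_rdivK x y : (rdiv y x * x <= y)%g.
Proof. by rewrite le_mul_rdiv. Qed.

Lemma rl_exp_le1 p n : p <= 1%g -> (p ^+ n <= 1)%g.
Proof.
move=> p1; elim: n => // n IH.
by rewrite expgS -[X in _ <= X]mulg1 rl_le_mul.
Qed.

Lemma rl_le_exp p q n : p <= q -> (p ^+ n <= q ^+ n)%g.
Proof. by move=> pq; elim: n => // n IH; rewrite !expgS rl_le_mul. Qed.

Lemma rl_expU p q m n : p <= 1%g -> q <= 1%g ->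
  ((p `|` q) ^+ (m + n) <= p ^+ m `|` q ^+ n)%g.
Proof.
move=> p1 q1; have pq1 : p `|` q <= 1%g by rewrite leUx p1.
elim: m n => [|m IHm] n.
  by apply: (le_trans _ (leUl _ _)); apply: rl_exp_le1.
elim: n => [|n IHn].
  by apply: (le_trans _ (leUr _ _)); apply: rl_exp_le1.
rewrite addSn expgS rl_mulUl leUx; apply/andP; split.
  apply: le_trans (rl_le_mul2l p (IHm n.+1)) _.
  rewrite rl_mulUr -expgS leUx leUl/=; apply: (le_trans _ (leUr _ _)).
  by rewrite -[X in _ <= X]mul1g rl_le_mul2r.
rewrite addnS -addSn; apply: le_trans (rl_le_mul2l q IHn) _.
rewrite rl_mulUr -expgS leUx leUr andbT; apply: (le_trans _ (leUl _ _)).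
by rewrite -[X in _ <= X]mul1g rl_le_mul2r.
Qed.

End Residuation.

Section AbsoluteValue.
Context {d : Order.disp_t} {L : ecyclicRLType d}.
Implicit Types (x y z p q a b : L) (A : convexSubalgebra L).

(* |x| = x /\ (e/x) /\ e *)
Definition rl_abs x : L := x `&` rdiv 1%g x `&` 1%g.

Lemma rl_cyc x y : (x * y <= 1)%g = (y * x <= 1)%g.
Proof. by rewrite le_mul_rdiv ecyclic -le_mul_ldiv. Qed.

Lemma le_rl_abs p x :
  p <= rl_abs x <-> [/\ p <= x, (p * x <= 1)%g & p <= 1%g].
Proof.
rewrite /rl_abs !lexI -le_mul_rdiv; split=> [/andP[/andP[]]|[-> -> ->]] //.
Qed.

Lemma rl_abs_le1 x : rl_abs x <= 1%g.
Proof. exact: leIr. Qed.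

Lemma rl_abs_id p : p <= 1%g -> rl_abs p = p.
Proof.
move=> p1; apply/eqP; rewrite eq_le; apply/andP; split.
  by rewrite /rl_abs -meetA leIl.
apply/le_rl_abs; split=> //.
by rewrite -[X in _ <= X]mulg1 rl_le_mul.
Qed.

Lemma csub_abs A x : csub_set A x <-> csub_set A (rl_abs x).
Proof.
have cA := csubP A; have A1 := csub_one cA; split=> Ax.
  by do 2!apply: csub_meet => //; apply: csub_rdiv.
have [xx x1 _] : [/\ rl_abs x <= x, (rl_abs x * x <= 1)%g & rl_abs x <= 1%g].
  exact/le_rl_abs.
move: x1; rewrite le_mul_ldiv; apply: (csub_convex cA Ax) => //.
exact: csub_ldiv.
Qed.

Definition powers_below p : set L := fun x => exists n, (p ^+ n <= rl_abs x)%g.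

Lemma powers_belowP p : p <= 1%g -> is_convex_subalgebra (powers_below p).
Proof.
move=> p1.
have ple1 n : (p ^+ n <= 1)%g by apply: rl_exp_le1.
have weak m n x : (p ^+ m <= rl_abs x)%g -> (p ^+ (m + n) <= rl_abs x)%g.
  apply: le_trans; rewrite expgnDr -[X in _ <= X]mulg1.
  exact: rl_le_mul2l.
have common x y : powers_below p x -> powers_below p y -> exists k,
    [/\ [/\ (p ^+ k <= x)%g & (p ^+ k * x <= 1)%g]
      & [/\ (p ^+ k <= y)%g & (p ^+ k * y <= 1)%g]].
  move=> [m px] [n py]; exists (m + n)%N; split.
    by have /le_rl_abs[] := weak m n x px.
  by rewrite addnC; have /le_rl_abs[] := weak n m y py.
split=> [|x y Bx By|x y Bx By|x y Bx By|x y Bx By|x y Bx By|x y z Bx Bz xy yz].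
- by exists 0%N; apply/le_rl_abs; rewrite expg0 mulg1.
- have [k [[ux ux1] [uy uy1]]] := common _ _ Bx By.
  exists (k + k)%N; apply/le_rl_abs; split => //; rewrite expgnDr.
    exact: rl_le_mul.
  apply: le_trans uy1; rewrite -mulgA; apply: rl_le_mul2l.
  by rewrite mulgA -[X in _ <= X]mul1g; apply: rl_le_mul2r.
- have [k [[ux ux1] [uy uy1]]] := common _ _ Bx By.
  exists (k + k)%N; apply/le_rl_abs; split => //; rewrite expgnDr.
    rewrite -le_mul_ldiv; apply: le_trans uy; rewrite mulgA.
    by rewrite -[X in _ <= X]mul1g; apply: rl_le_mul2r; rewrite rl_cyc.
  rewrite rl_cyc in uy1; rewrite -mulgA rl_cyc; apply: le_trans uy1.
  apply: rl_le_mul2r; apply: le_trans (rl_ldivK x y); exact: rl_le_mul2r.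
- have [k [[ux ux1] [uy uy1]]] := common _ _ Bx By.
  exists (k + k)%N; apply/le_rl_abs; split => //; rewrite expgnDr.
    rewrite -le_mul_rdiv; apply: le_trans ux; rewrite -mulgA.
    by rewrite -[X in _ <= X]mulg1; apply: rl_le_mul2l.
  rewrite rl_cyc in ux1; rewrite rl_cyc mulgA; apply: le_trans ux1.
  apply: rl_le_mul2r; apply: le_trans (rl_rdivK y x); exact: rl_le_mul2l.
- have [k [[ux ux1] [uy uy1]]] := common _ _ Bx By.
  exists k; apply/le_rl_abs; split => //; first by rewrite lexI ux.
  by apply: le_trans ux1; apply: rl_le_mul2l; apply: leIl.
- have [k [[ux ux1] [uy uy1]]] := common _ _ Bx By.
  exists k; apply/le_rl_abs; split => //; first exact: le_trans ux (leUl _ _).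
  by rewrite rl_mulUr leUx ux1.
- have [k [[ux ux1] [uz uz1]]] := common _ _ Bx Bz.
  exists k; apply/le_rl_abs; split => //; first exact: le_trans ux xy.
  by apply: le_trans uz1; apply: rl_le_mul2l.
Qed.

Lemma csub_exp A x n : csub_set A x -> csub_set A (x ^+ n)%g.
Proof.
move=> Ax; have cA := csubP A; elim: n => [|n IH]; first exact: csub_one.
by rewrite expgS; apply: csub_mul.
Qed.

Lemma mem_csub1 p x : p <= 1%g ->
  csub_set (csub1 p) x <-> exists n, (p ^+ n <= rl_abs x)%g.
Proof.
move=> p1; split=> [px|[n px]].
  suff : (csub_set (csub1 p) `<=` powers_below p)%classic by apply.
  apply: smallest_sub; first exact: powers_belowP.
  by move=> _ ->; exists 1%N; rewrite rl_abs_id.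
apply/csub_abs; have cp := csubP (csub1 p).
apply: (csub_convex cp _ (csub_one cp) px (rl_abs_le1 x)).
by apply: csub_exp; apply: csub1_mem.
Qed.

Lemma csub1_abs a : csub1 (rl_abs a) = csub1 a.
Proof.
apply/eqP; rewrite eq_le; apply/andP; split; apply: (iffRL (csub1_le _ _)).
  by apply: (iffLR (csub_abs _ _)); apply: csub1_mem.
by apply: (iffRL (csub_abs _ _)); apply: csub1_mem.
Qed.

Lemma csub1_meet p q : p <= 1%g -> q <= 1%g ->
  csub1 p `&` csub1 q = csub1 (p `|` q).
Proof.
move=> p1 q1; have pq1 : p `|` q <= 1%g by rewrite leUx p1.
apply/eqP; rewrite eq_le; apply/andP; split.
  apply/csub_leP => x [/(mem_csub1 _ p1)[m pm] /(mem_csub1 _ q1)[n qn]].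
  apply/(mem_csub1 _ pq1); exists (m + n)%N.
  by apply: le_trans (rl_expU _ _ p1 q1) _; rewrite leUx pm.
rewrite lexI; apply/andP; split; apply: (iffRL (csub1_le _ _)).
  have cp := csubP (csub1 p).
  by apply: (csub_convex cp (csub1_mem p) (csub_one cp)) => //; apply: leUl.
have cq := csubP (csub1 q).
by apply: (csub_convex cq (csub1_mem q) (csub_one cq)) => //; apply: leUr.
Qed.

Lemma csub1_join p q : p <= 1%g -> q <= 1%g ->
  csub1 p `|` csub1 q = csub1 (p `&` q).
Proof.
move=> p1 q1; have pq1 : p `&` q <= 1%g by apply: le_trans p1; apply: leIl.
apply/eqP; rewrite eq_le; apply/andP; split.
  have cpq := csubP (csub1 (p `&` q)).
  rewrite leUx; apply/andP; split; apply: (iffRL (csub1_le _ _));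
    apply: (csub_convex cpq (csub1_mem _) (csub_one cpq)) => //.
    exact: leIl.
  exact: leIr.
apply: (iffRL (csub1_le _ _)); apply: (csub_meet (csubP _)); apply/csub1_le.
  exact: leUl.
exact: leUr.
Qed.

Lemma csub1_distr p q r : p <= 1%g -> q <= 1%g -> r <= 1%g ->
  (csub1 p `|` csub1 q) `&` csub1 r =
  (csub1 p `&` csub1 r) `|` (csub1 q `&` csub1 r).
Proof.
move=> p1 q1 r1; have pq1 : p `&` q <= 1%g by apply: le_trans p1; apply: leIl.
apply/eqP; rewrite eq_le; apply/andP; split; last first.
  by rewrite leUx !lexI !leIr (le_trans (leIl _ _)) ?leUl//=
    (le_trans (leIl _ _)) ?leUr.
have pr1 : p `|` r <= 1%g by rewrite leUx p1.
have qr1 : q `|` r <= 1%g by rewrite leUx q1.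
rewrite csub1_join// !csub1_meet// csub1_join//; apply: (iffRL (csub1_le _ _)).
have s1 : (p `|` r) `&` (q `|` r) <= 1%g.
  by apply: le_trans pr1; apply: leIl.
apply/mem_csub1 => //; exists 2%N.
rewrite rl_abs_id; last by rewrite leUx pq1.
rewrite expgS expg1; apply: le_trans (rl_le_mul (leIl _ _) (leIr _ _)) _.
rewrite rl_mulUl rl_mulUr !leUx; apply/andP; split; [apply/andP; split|].
- apply: le_trans (leUl _ _); rewrite lexI; apply/andP; split.
    by rewrite -[X in _ <= X]mulg1; apply: rl_le_mul2l.
  by rewrite -[X in _ <= X]mul1g; apply: rl_le_mul2r.
- apply: le_trans (leUr _ _).
  by rewrite -[X in _ <= X]mul1g; apply: rl_le_mul2r.
- apply: le_trans (leUr _ _).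
  by rewrite -[X in _ <= X]mulg1; apply: rl_le_mul2l.
Qed.

Lemma is_principalP A :
  reflect (exists2 p, p <= 1%g & A = csub1 p) (is_principal A).
Proof.
apply: (iffP (asboolP _)) => [[a ->]|[p _ ->]]; last by exists p.
by exists (rl_abs a); [apply: rl_abs_le1|rewrite csub1_abs].
Qed.

Lemma is_principal_meet A B :
  is_principal A -> is_principal B -> is_principal (A `&` B).
Proof.
move=> /is_principalP[p p1 ->] /is_principalP[q q1 ->].
by apply/asboolP; exists (p `|` q); apply: csub1_meet.
Qed.

Lemma is_principal_join A B :
  is_principal A -> is_principal B -> is_principal (A `|` B).
Proof.
move=> /is_principalP[p p1 ->] /is_principalP[q q1 ->].
by apply/asboolP; exists (p `&` q); apply: csub1_join.
Qed.

End AbsoluteValue.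

Section PrincipalConvexSubalgebras.
Context {d : Order.disp_t}.

Record principalConvexSubalgebra (L : ecyclicRLType d) :=
  PrincipalConvexSubalgebra {
    pcsub_val : convexSubalgebra L;
    _ : is_principal pcsub_val
  }.

Variable L : ecyclicRLType d.
Local Notation K := (principalConvexSubalgebra L).

HB.instance Definition _ := [isSub for @pcsub_val L].
HB.instance Definition _ := [Choice of K by <:].
HB.instance Definition _ := [SubChoice_isSubPOrder of K by <: with set_display].

Fact is_principal_meet_closed : meet_closed (@is_principal d L).
Proof. exact: is_principal_meet. Qed.

Fact is_principal_join_closed : join_closed (@is_principal d L).
Proof. exact: is_principal_join. Qed.

HB.instance Definition _ :=
  Order.SubPOrder_isSubLattice.Build set_display (convexSubalgebra L)
    (@is_principal d L) set_display K
    is_principal_meet_closed is_principal_join_closed.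

Lemma pcsub_meetE (A B : K) :
  pcsub_val (A `&` B) = pcsub_val A `&` pcsub_val B.
Proof. by []. Qed.

Lemma pcsub_joinE (A B : K) :
  pcsub_val (A `|` B) = pcsub_val A `|` pcsub_val B.
Proof. by []. Qed.

Lemma pcsub_leP (A B : K) :
  (A <= B) <-> (csub_set (pcsub_val A) `<=` csub_set (pcsub_val B))%classic.
Proof. by rewrite -csub_leP -Order.le_val. Qed.

Fact pcsub_meetUl : @left_distributive K K Order.meet Order.join.
Proof.
move=> A B C; apply: val_inj => /=.
have /is_principalP[p p1 ->] := valP A.
have /is_principalP[q q1 ->] := valP B.
have /is_principalP[r r1 ->] := valP C.
exact: csub1_distr.
Qed.

HB.instance Definition _ :=
  Order.Lattice_Meet_isDistrLattice.Build set_display K pcsub_meetUl.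

(* The least principal convex subalgebra, C[e]. *)
Definition pcsub_bottom : K :=
  PrincipalConvexSubalgebra (asboolT (ex_intro _ 1%g erefl)).

Fact pcsub_bottom_le (A : K) : pcsub_bottom <= A.
Proof. by rewrite -Order.le_val; apply: (iffRL (csub1_le _ _)); apply: csub_one (csubP _). Qed.

HB.instance Definition _ :=
  Order.hasBottom.Build set_display K pcsub_bottom_le.

End PrincipalConvexSubalgebras.

Section RelativelyNormal.
Context {d : Order.disp_t}.

Record is_ideal (M : latticeType d) (I : set M) : Prop := IsIdeal {
  ideal_nonempty : exists x, I x;
  ideal_down : forall x y, x <= y -> I y -> I x;
  ideal_join : forall x y, I x -> I y -> I (x `|` y)
}.

Record is_prime_ideal (M : latticeType d) (I : set M) : Prop := IsPrimeIdeal {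
  prime_ideal_ideal : is_ideal I;
  prime_ideal_proper : exists x, ~ I x;
  prime_ideal_meet : forall x y, I (x `&` y) -> I x \/ I y
}.

(* The prime ideals containing a given prime ideal P form a chain. *)
Definition relatively_normal (M : bDistrLatticeType d) : Prop :=
  forall P Q R : set M,
    is_prime_ideal P -> is_prime_ideal Q -> is_prime_ideal R ->
    (P `<=` Q)%classic -> (P `<=` R)%classic ->
    (Q `<=` R)%classic \/ (R `<=` Q)%classic.

End RelativelyNormal.

(* Main.v *)
(* If [u = (p\q) /\ e] and [v = (q\p) /\ e] with [p, q <= e], then [p u <= q] and
   [q v <= p], so C[q] is below C[p] \/ C[u] and C[p] is below C[q] \/ C[v], while
   prelinearity gives C[u] /\ C[v] = C[u \/ v] = C[e]. A prime ideal P thus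
   contains C[u] or C[v], and an ideal above P containing C[p] (resp. C[q]) then
   contains C[q] (resp. C[p]); two incomparable ideals above P would be separated
   by such a pair. *)
Require Import Defs.
From HB Require Import structures.
From mathcomp Require Import all_boot all_order.
From mathcomp Require Import boolp classical_sets.

Import Order.TTheory.

Section PrelinearCaseSplit.
Local Open Scope order_scope.

Lemma prime_ideal_bottom (d : Order.disp_t) (M : bDistrLatticeType d)
    (P : set M) : is_prime_ideal P -> P \bot.
Proof.
by case=> -[[x Px] down _] _ _; apply: down Px; apply: le0x.
Qed.

Lemma relatively_normal_splitting (d : Order.disp_t) (M : bDistrLatticeType d) :
  (forall a b : M, exists u v,
     [/\ u `&` v = \bot, b <= a `|` u & a <= b `|` v]) ->
  relatively_normal M.
Proof.
move=> split_ab P Q R pP [iQ _ _] [iR _ _] PQ PR.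
have [QR|/existsNP[a /not_implyP[Qa nRa]]] := EM (Q `<=` R)%classic.
  by left.
right=> b Rb.
(* Here [a] is in Q but not in R, and [b] is in R. If [u] is in P, then [b] falls into Q; if [v] is
   in P, then [a] falls into R, a contradiction. *)
have [u [v [uv0 bau abv]]] := split_ab a b.
have [Pu|Pv] : P u \/ P v.
- by apply: (prime_ideal_meet pP); rewrite uv0; apply: prime_ideal_bottom.
- by apply: (ideal_down iQ bau); apply: (ideal_join iQ) => //; apply: PQ.
- case: nRa; apply: (ideal_down iR abv); apply: (ideal_join iR) => //.
  exact: PR.
Qed.

Lemma csub_between (d : Order.disp_t) (L : residuatedLatticeType d)
    (A : convexSubalgebra L) (x y : L) :
  csub_set A x -> x <= y -> y <= 1%g -> csub_set A y.
Proof.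
by move=> Ax; apply: (csub_convex (csubP A)) => //; apply: csub_one (csubP A).
Qed.

(** The join contains [p * u] and e, hence by convexity also [q], which lies between them. *)
Lemma csub1_le_joinl (d : Order.disp_t) (L : residuatedLatticeType d)
    (p q u : L) :
  (p * u <= q)%g -> q <= 1%g -> csub1 q <= csub1 p `|` csub1 u.
Proof.
move=> puq q1; apply/csub1_le; apply: csub_between puq q1.
apply: (csub_mul (csubP _)); apply/csub1_le; [exact: leUl|exact: leUr].
Qed.

Lemma csub1_le_joinr (d : Order.disp_t) (L : residuatedLatticeType d)
    (p q u : L) :
  (u * p <= q)%g -> q <= 1%g -> csub1 q <= csub1 p `|` csub1 u.
Proof. by rewrite joinC; apply: csub1_le_joinl. Qed.

Lemma prelinear_csub1_splitting (d : Order.disp_t) (L : ecyclicRLType d)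
    (p q : L) :
  left_prelinear L \/ right_prelinear L -> p <= 1%g -> q <= 1%g ->
  exists u v : L, [/\ u <= 1%g, v <= 1%g, u `|` v = 1%g,
    csub1 q <= csub1 p `|` csub1 u & csub1 p <= csub1 q `|` csub1 v].
Proof.
move=> [lp|rp] p1 q1.
(* Left residuals give [p * u <= q]; the right residuals below give [u * p <= q]. *)
- exists (ldiv p q `&` 1%g), (ldiv q p `&` 1%g).
  by split; rewrite ?leIr ?lp //; apply: csub1_le_joinl => //;
    rewrite le_mul_ldiv leIl.
- exists (rdiv q p `&` 1%g), (rdiv p q `&` 1%g).
  by split; rewrite ?leIr ?rp //; apply: csub1_le_joinr => //;
    rewrite le_mul_rdiv leIl.
Qed.

End PrelinearCaseSplit.

Theorem proposition4p5 (d : Order.disp_t) (L : ecyclicRLType d)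
    (prelin : left_prelinear L \/ right_prelinear L) :
  relatively_normal (principalConvexSubalgebra L).
Proof.
apply: relatively_normal_splitting => A B.
(* Replacing a generator by its absolute value gives [p, q <= e]. *)
have /is_principalP[p p1 Ap] := valP A.
have /is_principalP[q q1 Bq] := valP B.
have [u [v [u1 v1 uv qpu pqv]]] := prelinear_csub1_splitting _ _ p q prelin p1 q1.
exists (PrincipalConvexSubalgebra (asboolT (ex_intro _ u erefl))).
exists (PrincipalConvexSubalgebra (asboolT (ex_intro _ v erefl))).
split.
- by apply: val_inj => /=; rewrite csub1_meet// uv.
- by rewrite -Order.le_val /= Ap Bq.
- by rewrite -Order.le_val /= Ap Bq.
Qed.
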